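(* Let $n\ge1$, $p\in(1,2)$, $k_3>0$, and let $k_1,k_2>0$ be such that $\mathcal{A}^*=\begin{bmatrix}-k_1&1\\-k_2&0\end{bmatrix}$ is Hurwitz. Let $\phi_1,\phi_2:\mathbb{R}^n\to\mathbb{R}^n$ be $$\phi_1(e_1)=k_3e_1+(e_1^{T}e_1)^{\frac{1-p}{3p-2}}e_1,$$ $$\phi_2(e_1)=k_3^2e_1+\frac{2k_3(2p-1)}{3p-2}(e_1^{T}e_1)^{\frac{1-p}{3p-2}}e_1+\frac{p}{3p-2}(e_1^{T}e_1)^{\frac{2(1-p)}{3p-2}}e_1 .$$ Let $\mathcal{Q}^*\in\mathbb{R}^{2\times2}$ be symmetric positive definite, let $\mathcal{P}^*\succ0$ be the unique solution of $(\mathcal{A}^* )^T\mathcal{P}^*+\mathcal{P}^*\mathcal{A}^*=-\mathcal{Q}^*$, let $\mathcal{P}=\mathcal{P}^*\otimes I_n$, $\mathcal{Q}=\mathcal{Q}^*\otimes I_n$ (Kronecker products with the $n\times n$ identity), and set $$\gamma_1=k_3\frac{\lambda_{\min}\{\mathcal{Q}\}}{\lambda_{\max}\{\mathcal{P}\}} .$$ Consider the system under measurement noise $$\dot e_1=-k_1\phi_1(e_1+\mu)+e_2,\qquad \dot e_2=-k_2\phi_2(e_1+\mu),$$ where the (possibly time-varying) noise $\mu\in\mathbb{R}^n$ is bounded as $\|\mu\|\le\bar\mu$. If $$\gamma_1\ge\frac{\lambda_{\max}\{\mathcal{P}\}}{\lambda_{\min}\{\mathcal{P}\}},$$ then this system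 is practically finite-time stable at the origin.
   Context: $\lambda_{\min}\{\cdot\}$ and $\lambda_{\max}\{\cdot\}$ denote the minimum and maximum eigenvalue of a matrix. The functions $\phi_1,\phi_2$ take the value $0$ at $0$ (continuous extension). Solutions are absolutely continuous functions satisfying the differential equation almost everywhere. Practical finite-time stability (PFTS) at the origin: there is a bounded neighborhood of the origin, depending only on the system parameters and the bound on the noise (not on the initial condition), such that every solution enters this neighborhood in finite time and remains in it thereafter. (In the paper this is the property implied by a Lyapunov inequality $\dot V\le-\lambda_1V-\lambda_2V^\alpha+\eta$ with $\lambda_1,\lambda_2>0$, $\alpha\in(0,1)$, the neighborhood being $\{V\le\min\{\frac{\eta}{(1-\theta_0)\lambda_1},(\frac{\eta}{(1-\theta_0)\lambda_2})^{1/\alpha}\}\}$ with $0<\theta_0<1$.) *)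

(* Defs.v *)
From HB Require Import structures.
From mathcomp Require Import all_boot all_order all_algebra.
From mathcomp Require Import complex mxtens.
From mathcomp Require Import all_classical all_reals all_analysis.

Set Implicit Arguments.
Unset Strict Implicit.
Unset Printing Implicit Defensive.

Import Order.TTheory GRing.Theory Num.Theory numFieldNormedType.Exports.

Local Open Scope classical_set_scope.
Local Open Scope ring_scope.

(** The norm that MathComp-Analysis puts on matrices is the sup norm; the
    Euclidean norm of a column vector is [enorm]. *)
Definition edot (R : realType) (n : nat) (x y : 'cV[R]_n) : R :=
  (x^T *m y) 0 0.

Definition enorm (R : realType) (n : nat) (x : 'cV[R]_n) : R :=
  Num.sqrt (edot x x).

Definition hurwitz (R : realType) (m : nat) (A : 'M[R]_m) : Prop :=
  forall z : complex R,
    eigenvalue (map_mx (real_complex R) A) z -> complex.Re z < 0.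

Definition posdef (R : realType) (m : nat) (A : 'M[R]_m) : Prop :=
  A^T = A /\ forall x : 'cV[R]_m, x != 0 -> 0 < edot x (A *m x).

(** A matrix has finitely many eigenvalues, so as soon as it has a real one
    (e.g. a symmetric matrix of positive size) these extrema are attained. *)
Definition lambda_min (R : realType) (m : nat) (A : 'M[R]_m) : R :=
  inf [set a : R | eigenvalue A a].

Definition lambda_max (R : realType) (m : nat) (A : 'M[R]_m) : R :=
  sup [set a : R | eigenvalue A a].

Definition abs_continuous_on (R : realType) (V : normedModType R)
    (a b : R) (f : R -> V) : Prop :=
  forall eps : R, 0 < eps -> exists2 delta : R, 0 < delta &
    forall (m : nat) (u v : 'I_m -> R),
      (forall i, a <= u i /\ u i <= v i /\ v i <= b) ->
      trivIset [set: 'I_m] (fun i => [set` `]u i, v i[]) ->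
      \sum_(i < m) (v i - u i) < delta ->
      \sum_(i < m) `|f (v i) - f (u i)| < eps.

(** Solutions on [t0, +oo[ of x' = F (d t) x for the exogenous signal d:
    absolutely continuous on every compact subinterval, and satisfying the
    equation almost everywhere. *)
Definition is_solution (R : realType) (V : normedModType R) (D : Type)
    (F : D -> V -> V) (d : R -> D) (t0 : R) (x : R -> V) : Prop :=
  (forall b : R, t0 <= b -> abs_continuous_on t0 b x) /\
  {ae (@lebesgue_measure R),
     forall t : R, t0 <= t -> is_derive t 1 x (F (d t) (x t))}.

(** The neighborhood [N] is chosen before the signal, the initial time and the
    solution; only the entrance time [T] depends on them. *)
Definition practically_finite_time_stable (R : realType)
    (V : normedModType R) (D : Type) (admissible : set (R -> D))
    (F : D -> V -> V) : Prop :=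
  exists N : set V, [/\ nbhs (0 : V) N, bounded_set N &
    forall (d : R -> D) (t0 : R) (x : R -> V),
      admissible d -> is_solution F d t0 x ->
      exists2 T : R, t0 <= T & forall t : R, T <= t -> N (x t)].

(** For p in ]1, 2[ the exponents below are negative.  Since [0 `^ r = 0] for
    r != 0, both functions vanish at 0, which is their continuous extension. *)
Definition phi1 (R : realType) (n : nat) (p k3 : R) (e : 'cV[R]_n) :
    'cV[R]_n :=
  k3 *: e + (edot e e `^ ((1 - p) / (3 * p - 2))) *: e.

Definition phi2 (R : realType) (n : nat) (p k3 : R) (e : 'cV[R]_n) :
    'cV[R]_n :=
  k3 ^+ 2 *: e
  + (2 * k3 * (2 * p - 1) / (3 * p - 2)
       * edot e e `^ ((1 - p) / (3 * p - 2))) *: e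
  + (p / (3 * p - 2)
       * edot e e `^ (2 * (1 - p) / (3 * p - 2))) *: e.

Definition Astar (R : realType) (k1 k2 : R) : 'M[R]_2 :=
  block_mx (- k1)%:M 1%:M
           (- k2)%:M 0%:M : 'M[R]_(1 + 1).

Definition noisy_system (R : realType) (n : nat) (p k1 k2 k3 : R)
    (mu : 'cV[R]_n) (e : 'cV[R]_n * 'cV[R]_n) : 'cV[R]_n * 'cV[R]_n :=
  (- k1 *: phi1 p k3 (e.1 + mu) + e.2, - k2 *: phi2 p k3 (e.1 + mu)).

Definition gamma1 (R : realType) (m : nat) (k3 : R) (P Q : 'M[R]_m) : R :=
  k3 * (lambda_min Q / lambda_max P).

(* Main.v *)
(** In the coordinates (u, v) = (e1, e2 / k3) the system is k3 A* (u, v) plus a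
    perturbation that, the noise being bounded, grows more slowly than |e1|:
    the powers of |e1 + mu| in [phi1] and [phi2] multiplying e1 + mu are
    negative.  Hence the quadratic form W of P* in (u, v) satisfies W' <= -1
    wherever W >= M, for a constant M.  Along an absolutely continuous solution
    W therefore reaches {W <= M} in finite time and stays there.

    The step from almost everywhere derivatives to increments is an induction
    along the real line: the exceptional null set is covered by an open set U of
    measure < delta, the pieces straddling a good point contribute at most
    eps (y - x), and the pieces inside U at most eps in total. *)

From HB Require Import structures.
Require Import Defs.
From mathcomp Require Import all_boot all_order all_algebra.
From mathcomp Require Import complex mxtens.
From mathcomp Require Import all_classical all_reals all_analysis.
From mathcomp Require Import measurable_realfun.
From mathcomp Require Import ring lra.

Set Implicit Arguments.
Unset Strict Implicit.
Unset Printing Implicit Defensive.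

Import Order.TTheory GRing.Theory Num.Theory numFieldNormedType.Exports.
Local Open Scope classical_set_scope.
Local Open Scope ring_scope.

(** * Absolutely continuous functions *)

(** Real induction. At the supremum of the points of [[a, b]] where [P] holds, [P] crosses from a
    point just left of it to any point just right, so the supremum is [b]. *)
Lemma creeping_ind (R : realType) (P : R -> Prop) (a b : R) :
  a <= b -> P a ->
  (forall t, a <= t <= b -> exists2 r : R, 0 < r & forall x y,
     a <= x <= t -> t <= y <= b -> t - r < x -> y < t + r -> P x -> P y) ->
  P b.
Proof.
move=> ab Pa step; pose S := [set x | a <= x <= b /\ P x].
have Sa : S a by split => //; rewrite lexx.
have supS : has_sup S by split; [exists a | exists b => x [/andP[]]].
have ac : a <= sup S by exact: sup_upper_bound.
have cb : sup S <= b by apply: ge_sup; [exists a | move=> x [/andP[]]].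
have [r r0 Pstep] := step (sup S) ltac:(by rewrite ac cb).
have [x [/andP[ax xb] Px] xc] := sup_adherent r0 supS.
have xc' : x <= sup S by apply: sup_upper_bound => //; split=> //; exact/andP.
have up y : sup S <= y <= b -> y < sup S + r -> P y.
  by move=> cyb yr; apply: Pstep Px => //; rewrite ?ax.
have [cb'|bc] := ltP (sup S) b; last by apply: up; [rewrite cb lexx | lra].
pose y := Num.min b (sup S + r / 2).
have yb : y <= b by rewrite /y ge_min lexx.
have cy : sup S < y by rewrite /y lt_min cb'; lra.
have yr : y < sup S + r by rewrite /y gt_min; apply/orP; right; lra.
have : y <= sup S.
  apply: sup_upper_bound => //; split; first by rewrite yb andbT; lra.
  by apply: up => //; rewrite yb ltW.
by move=> /(lt_le_trans cy); rewrite ltxx.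
Qed.

Lemma abs_continuous_on_sub (R : realType) (V : normedModType R) (a b c d : R)
    (f : R -> V) :
  a <= c -> d <= b -> abs_continuous_on a b f -> abs_continuous_on c d f.
Proof.
move=> ac db acf e e0; have [D D0 fD] := acf e e0; exists D => // m u v uv.
by apply: fD => i; have [? []] := uv i; split; [lra | split; lra].
Qed.

Lemma abs_continuous_on_near (R : realType) (V : normedModType R) (a b : R)
    (f : R -> V) : abs_continuous_on a b f ->
  forall e : R, 0 < e -> exists2 d : R, 0 < d &
    forall u v, a <= u -> u <= v -> v <= b -> v - u < d -> `|f v - f u| < e.
Proof.
move=> acf e e0; have [D D0 fD] := acf e e0; exists D => // u v au uv vb vu.
have := fD 1%N (fun=> u) (fun=> v); rewrite !big_ord1; apply => //.
by apply/trivIsetP => i j _ _; rewrite !ord1 eqxx.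
Qed.

Lemma abs_continuous_on_bounded (R : realType) (V : normedModType R) (a b : R)
    (f : R -> V) : a <= b -> abs_continuous_on a b f ->
  exists B : R, forall t, a <= t <= b -> `|f t| <= B.
Proof.
move=> ab acf; have [d d0 fd] := abs_continuous_on_near acf ltr01.
apply: (@creeping_ind _
  (fun y => exists B : R, forall t, a <= t <= y -> `|f t| <= B) a b) => //.
  by exists `|f a| => t /andP[at_ ta]; rewrite (@le_anti _ _ t a) ?lexx// at_ ta.
(* Points within [d / 2] of [t] are less than [d] apart, so the bound grows by at most 1 across
   [t]. *)
move=> t /andP[at_ tb]; exists (d / 2) => [|x y]; first by rewrite divr_gt0.
move=> /andP[ax xt] /andP[ty yb] dx yd [B fB].
exists (B + 1) => s /andP[as_ sy]; have [sx|xs] := leP s x.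
  by apply: le_trans (fB s _) _; rewrite ?as_ ?sx // lerDl.
have -> : f s = f x + (f s - f x) by rewrite addrC subrK.
apply: le_trans (ler_normD _ _) _; apply: lerD; first by apply: fB; rewrite ax lexx.
by apply/ltW/fd; lra.
Qed.

Lemma abs_continuous_on_lip (R : realType) (V W : normedModType R) (a b k : R)
    (f : R -> V) (g : R -> W) :
  (forall s t, a <= s <= b -> a <= t <= b -> `|g t - g s| <= k * `|f t - f s|) ->
  abs_continuous_on a b f -> abs_continuous_on a b g.
Proof.
move=> gf acf e e0.
have k0 : 0 < `|k| + 1 by rewrite ltr_wpDl.
have [d d0 fd] := acf (e / (`|k| + 1)) (divr_gt0 e0 k0).
exists d => // m u v uv tuv luv.
apply: (@le_lt_trans _ _ ((`|k| + 1) * \sum_(i < m) `|f (v i) - f (u i)|)).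
  rewrite mulr_sumr; apply: ler_sum => i _.
  have [au [uv_ vb]] := uv i.
  apply: le_trans (gf _ _ _ _) _; [lra|lra|].
  by rewrite ler_wpM2r// (le_trans (ler_norm k))// lerDl.
by rewrite mulrC -ltr_pdivlMr// fd.
Qed.

Lemma abs_continuous_onD (R : realType) (V : normedModType R) (a b : R)
    (f g : R -> V) :
  abs_continuous_on a b f -> abs_continuous_on a b g ->
  abs_continuous_on a b (f + g).
Proof.
move=> acf acg e e0; have e20 : 0 < e / 2 by rewrite divr_gt0.
have [d d0 fd] := acf _ e20; have [d' d'0 gd] := acg _ e20.
exists (Num.min d d'); first by rewrite lt_min d0.
move=> m u v uv tuv; rewrite lt_min => /andP[ld ld'].
rewrite [e]splitr; apply: le_lt_trans (ltrD (fd m u v uv tuv ld) (gd m u v uv tuv ld')).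
rewrite -big_split; apply: ler_sum => i _ /=.
by rewrite fctE opprD addrACA ler_normD.
Qed.

Lemma abs_continuous_onM (R : realType) (a b : R) (f g : R -> R) : a <= b ->
  abs_continuous_on a b f -> abs_continuous_on a b g ->
  abs_continuous_on a b (f * g).
Proof.
move=> ab acf acg e e0; have e20 : 0 < e / 2 by rewrite divr_gt0.
have [A fA] := abs_continuous_on_bounded ab acf.
have [B gB] := abs_continuous_on_bounded ab acg.
have A1 : 0 < `|A| + 1 by rewrite ltr_wpDl.
have B1 : 0 < `|B| + 1 by rewrite ltr_wpDl.
have [d d0 fd] := acf _ (divr_gt0 e20 B1).
have [d' d'0 gd] := acg _ (divr_gt0 e20 A1).
exists (Num.min d d'); first by rewrite lt_min d0.
move=> m u v uv tuv; rewrite lt_min => /andP[ld ld'].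
have := ltrD (fd m u v uv tuv ld) (gd m u v uv tuv ld').
set s := \sum_(i < m) _; set s' := \sum_(i < m) _ => _.
apply: (@le_lt_trans _ _ ((`|B| + 1) * s + (`|A| + 1) * s')); last first.
  rewrite [e]splitr; apply: ltrD.
    by rewrite mulrC -ltr_pdivlMr// fd.
  by rewrite mulrC -ltr_pdivlMr// gd.
rewrite /s /s' !mulr_sumr -big_split; apply: ler_sum => i _ /=.
have [au [uv_ vb]] := uv i.
have -> : (f * g) (v i) - (f * g) (u i) =
   g (v i) * (f (v i) - f (u i)) + f (u i) * (g (v i) - g (u i)).
  by rewrite !fctE; ring.
apply: le_trans (ler_normD _ _) _; rewrite !normrM; apply: lerD.
  rewrite ler_wpM2r// (le_trans (gB _ _)) //; first lra.
  by rewrite (le_trans (ler_norm B))// lerDl.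
rewrite ler_wpM2r// (le_trans (fA _ _)) //; first lra.
by rewrite (le_trans (ler_norm A))// lerDl.
Qed.

Lemma abs_continuous_on_sum (R : realType) (V : normedModType R) (a b : R)
    (n : nat) (f : 'I_n -> R -> V) :
  (forall i, abs_continuous_on a b (f i)) ->
  abs_continuous_on a b (\sum_(i < n) f i).
Proof.
move=> acf; elim/big_ind : _ => //; last exact: abs_continuous_onD.
move=> e e0; exists 1 => // m u v _ _ _.
by rewrite big1// => i _; rewrite subrr normr0.
Qed.

(** * Increments from derivatives almost everywhere *)

Lemma is_derive1_near (R : realType) (V : normedModType R) (f : R -> V) (t : R) (l : V) :
  is_derive t 1 f l ->
  forall e, 0 < e -> exists2 r : R, 0 < r &
    forall s, `|s - t| < r -> `|f s - f t - (s - t) *: l| <= e * `|s - t|.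
Proof.
move=> [df <-] e e0.
have : (h^-1 *: ((f \o shift t) (h *: 1) - f t) @[h --> 0^']) --> 'D_1 f t by exact: df.
move=> /cvgrPdist_le /(_ e e0); rewrite near_withinE => /nbhs_ballP[r r0 fr].
exists r => // s st; have [->|nst] := eqVneq s t.
  by rewrite !subrr scale0r subr0 !normr0 mulr0.
have st0 : s - t != 0 by rewrite subr_eq0.
have := fr (s - t); rewrite /ball /= sub0r normrN => /(_ st st0).
have -> : (s - t) *: (1:R) + t = s by rewrite scaler1 subrK.
move=> H.
have -> : f s - f t - (s - t) *: 'D_1 f t =
   - ((s - t) *: ('D_1 f t - (s - t)^-1 *: (f s - f t))).
  by rewrite scalerBr scalerA mulfV// scale1r opprB.
by rewrite normrN normrZ mulrC ler_wpM2r.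
Qed.

Lemma sum_itv_le_measure (R : realType) (U : set R) (m : nat) (u v : 'I_m -> R) :
  measurable U -> (forall i, u i <= v i) ->
  trivIset [set: 'I_m] (fun i => [set` `]u i, v i[]) ->
  (forall i, [set` `]u i, v i[] `<=` U) ->
  ((\sum_(i < m) (v i - u i))%:E <= lebesgue_measure U)%E.
Proof.
move=> mU uv tuv uvU.
have -> : ((\sum_(i < m) (v i - u i))%:E =
    lebesgue_measure (\bigcup_(i in [set: 'I_m]) [set` `]u i, v i[]) :> \bar R)%E.
  have fT : finite_set [set: 'I_m] by exact: finite_finset.
  rewrite measure_fin_bigcup => [||//|i _]; [|exact: fT|exact: measurable_itv].
  have -> : [set: 'I_m] = [set` index_enum 'I_m].
    by apply/seteqP; split => // i _; exact: mem_index_enum.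
  rewrite -(fsbig_seq _ _ (index_enum_uniq _)) -sumEFin; apply: eq_bigr => i _.
  apply: etrans (esym (lebesgue_measure_itv _)) => /=; case: ifPn => //.
  by rewrite lte_fin -leNgt => vu; congr (_%:E); have := uv i; lra.
apply: le_measure; rewrite ?inE //; last by move=> x [i _ /uvU].
by apply: fin_bigcup_measurable => //; exact: finite_finset.
Qed.

Lemma abs_continuous_on_nincr (R : realType) (a b : R) (f : R -> R) :
  a <= b -> abs_continuous_on a b f ->
  {ae lebesgue_measure, forall t : R, a <= t <= b ->
     exists2 l : R, l <= 0 & is_derive t 1 f l} ->
  f b <= f a.
Proof.
move=> ab acf [E [mE E0 Esub]].
apply/ler_addgt0Pr => e e0; rewrite -lerBlDl.
(* With [k = e / (b - a + 1)] the slope error [k * (b - a)] and the variation error [k] add up to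
   [e]. *)
suff H k : 0 < k -> f b - f a <= k * (b - a) + k.
  have ba : 0 < b - a + 1 by lra.
  have := H (e / (b - a + 1)) (divr_gt0 e0 ba).
  set k := e / _; have -> // : k * (b - a) + k = e by rewrite /k; field; lra.
move=> k0; have [d d0 fd] := acf k k0.
(* Outer regularity controls [U] minus [E]; as [E] is null, [U] itself has measure below the
   threshold [d] that absolute continuity gives for [k]. *)
have [U [oU EU mU]] : exists U : set R,
    [/\ open U, E `<=` U & (lebesgue_measure U < d%:E)%E].
  have [|U [oU EU mUE]] := lebesgue_regularity_outer mE _ d0; first by rewrite [X in (X < _)%E]E0.
  exists U; split => //; rewrite -(setDUK EU) measureU //=.
  - by rewrite [X in (X + _)%E]E0 add0e.
  - by apply: measurableD => //; exact: open_measurable.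
  - by rewrite setDE setICA setICr setI0.
(* Invariant of the real induction: up to [t], the increment is paid for by slope [k] and by the
   variation over finitely many disjoint intervals inside [U]. At [b] that variation is below
   [k]. *)
pose P (t : R) := exists (m : nat) (u v : 'I_m -> R),
  [/\ forall i, a <= u i /\ u i <= v i /\ v i <= t,
      trivIset [set: 'I_m] (fun i => [set` `]u i, v i[]),
      forall i, [set` `]u i, v i[] `<=` U &
      f t - f a <= k * (t - a) + \sum_(i < m) `|f (v i) - f (u i)|].
suff [m [u [v [uv tuv uvU fba]]]] : P b.
  apply: le_trans fba _; rewrite lerD2l; apply/ltW/fd => //.
  rewrite -lte_fin; apply: le_lt_trans mU; apply: sum_itv_le_measure => //.
    exact: open_measurable.
  by move=> i; have [_ []] := uv i.
apply: (@creeping_ind _ P a b) => // [|t /andP[at_ tb]].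
  exists 0%N, (fun=> a), (fun=> a); split => //; try by case.
  by rewrite big_ord0 !subrr mulr0 addr0.
(* An exceptional [t] has a ball inside [U]; the interval from [x] to [y] lies in it and joins the
   family at index [ord_max]. *)
have [Et|nEt] := pselect (E t).
  have /nbhs_ballP[r r0 rU] : nbhs t U by apply: open_nbhs_nbhs; split => //; exact: EU.
  exists r => // x y /andP[ax xt] /andP[ty yb] rx ry [m [u [v [uv tuv uvU fxa]]]].
  pose u' i := oapp u x (unlift (@ord_max m) i).
  pose v' i := oapp v y (unlift (@ord_max m) i).
  have E1 i : u' (widen_ord (leqnSn m) i) = u i.
    rewrite /u' (_ : widen_ord _ i = lift ord_max i) ?liftK//.
    by apply/val_inj; rewrite /= /bump leqNgt ltn_ord.
  have E2 i : v' (widen_ord (leqnSn m) i) = v i.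
    rewrite /v' (_ : widen_ord _ i = lift ord_max i) ?liftK//.
    by apply/val_inj; rewrite /= /bump leqNgt ltn_ord.
  have E3 : u' ord_max = x by rewrite /u' unlift_none.
  have E4 : v' ord_max = y by rewrite /v' unlift_none.
  have uvx i : v i <= x by have [_ []] := uv i.
  exists m.+1, u', v'; split.
  - move=> i; rewrite /u' /v'; case: (unliftP ord_max i) => [j|] _ /=.
      by have [? []] := uv j; split; [|split]; lra.
    by split; [|split]; lra.
  - apply/trivIsetP => i j _ _; rewrite /u' /v'.
    case: (unliftP ord_max i) => [i'|] -> /=; case: (unliftP ord_max j) => [j'|] -> /= ij.
    + move/trivIsetP : tuv; apply => //.
      by apply: contra_neq ij => ->.
    + apply/seteqP; split => // z [] /=; rewrite !in_itv /= => /andP[_ zv] /andP[xz _].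
      by have := uvx i'; lra.
    + apply/seteqP; split => // z [] /=; rewrite !in_itv /= => /andP[xz _] /andP[_ zv].
      by have := uvx j'; lra.
    + by rewrite eqxx in ij.
  - move=> i; rewrite /u' /v'; case: (unliftP ord_max i) => [j|] _ //=.
    move=> z; rewrite /= in_itv /= => /andP[xz zy]; apply: rU.
    by rewrite /ball /= ltr_norml; lra.
  - rewrite big_ord_recr /= E3 E4; under eq_bigr do rewrite E1 E2.
    have := ler_norm (f y - f x); have : k * (x - a) <= k * (y - a) by rewrite ler_pM2l//; lra.
    set s := \sum_(i < m) _ in fxa *; lra.
(* At a good point the family is kept. The first-order expansions at [x] and [y], on either side of
   [t], have errors adding up to [k * (y - x)], and the linear term is nonpositive. *)
have /contrapT H := contra_not (@Esub t) nEt.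
have [|l l0 df] := H; first by rewrite at_.
have [r r0 fr] := is_derive1_near df k0; exists r => // x y.
move=> /andP[ax xt] /andP[ty yb] rx ry [m [u [v [uv tuv uvU fxa]]]].
exists m, u, v; split => // [i|]; first by have [? []] := uv i; split; [|split]; lra.
have /fr : `|x - t| < r by rewrite ler0_norm; lra.
have /fr : `|y - t| < r by rewrite ger0_norm; lra.
rewrite (ger0_norm (_ : 0 <= y - t)) ?(ler0_norm (_ : x - t <= 0)); try lra.
rewrite !ler_norml => /andP[_ h1] /andP[h2 _].
have : l * (y - x) <= 0 by rewrite mulr_le0_ge0//; lra.
rewrite /GRing.scale /= in h1 h2.
lra.
Qed.

(** Subtracting the line of slope [k] leaves nonpositive derivatives. *)
Lemma abs_continuous_on_le_slope (R : realType) (a b k : R) (f : R -> R) :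
  a <= b -> abs_continuous_on a b f ->
  {ae lebesgue_measure, forall t : R, a <= t <= b ->
     exists2 l : R, l <= k & is_derive t 1 f l} ->
  f b - f a <= k * (b - a).
Proof.
move=> ab acf df; pose g : R -> R := - k \*: id.
have acid : abs_continuous_on a b (id : R -> R).
  move=> e e0; exists e => // m u v uv _ luv.
  by rewrite (eq_bigr (fun i => v i - u i))// => i _; have := uv i => ?; rewrite ger0_norm; lra.
have acg : abs_continuous_on a b g.
  apply: (abs_continuous_on_lip (k := `|k|)) acid => s t _ _.
  by rewrite /g -scalerBr normrZ normrN.
have dfg : {ae lebesgue_measure, forall t : R, a <= t <= b ->
     exists2 l : R, l <= 0 & is_derive t 1 (f + g) l}.
  apply: (@filterS _ _ (ae_filter_ringOfSetsType lebesgue_measure) _ _ _ df).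
  move=> t + atb => /(_ atb)[l lk dft]; exists (l + (- k *: 1)).
    by rewrite /GRing.scale /=; lra.
  by apply: is_deriveD.
have := abs_continuous_on_nincr ab (abs_continuous_onD acf acg) dfg.
by rewrite !fctE /g /= /GRing.scale /=; lra.
Qed.

(** While [f] stays above [M] it loses at least the elapsed time, hence it must come down; climbing
    back above [M] after a last passage would contradict this decrease. *)
Lemma eventually_le_of_derive_le (R : realType) (f : R -> R) (t0 M : R) :
  (forall b, t0 <= b -> abs_continuous_on t0 b f) ->
  {ae lebesgue_measure, forall t : R, t0 <= t -> M <= f t ->
     exists2 l : R, l <= -1 & is_derive t 1 f l} ->
  exists2 T : R, t0 <= T & forall t, T <= t -> f t <= M.
Proof.
move=> acf df.
have dec s t : t0 <= s -> s <= t -> (forall r, s <= r <= t -> M <= f r) ->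
    f t - f s <= -1 * (t - s).
  move=> t0s st Mf; apply: abs_continuous_on_le_slope => //.
    by apply: abs_continuous_on_sub (acf t _) => //; lra.
  apply: (@filterS _ _ (ae_filter_ringOfSetsType lebesgue_measure) _ _ _ df).
  by move=> r fr srt; apply: fr; [lra | exact: Mf].
have trap s t : t0 <= s -> s <= t -> f s <= M -> f t <= M.
  move=> t0s st fs; rewrite leNgt; apply/negP => Mt.
  have acst : abs_continuous_on s t f.
    by apply: abs_continuous_on_sub (acf t _) => //; lra.
  have [|d d0 fd] := abs_continuous_on_near acst (e := f t - M); first by lra.
  (* The supremum acts as the last time at or below [M]. Taking [r] less than [d / 2] before it and
     [y] at most [d / 4] after it keeps [f y] below [f t], whereas [f] does not increase from [y] to
     [t]. *)
  pose S := [set r | s <= r <= t /\ f r <= M].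
  have supS : has_sup S.
    by split; [exists s; rewrite /S /= lexx | exists t => r [/andP[]]].
  have d20 : 0 < d / 2 by rewrite divr_gt0.
  have [r [/andP[sr rt] fr] cr] := sup_adherent d20 supS.
  have rc : r <= sup S by apply: sup_upper_bound => //; split => //; rewrite sr.
  have ct : sup S <= t.
    by apply: ge_sup; [exists r; split => //; rewrite sr | move=> x [/andP[]]].
  pose y := Num.min t (sup S + d / 4).
  have yt : y <= t by rewrite /y ge_min lexx.
  have yc : y <= sup S + d / 4 by rewrite /y ge_min lexx orbT.
  have cy : sup S <= y by rewrite /y le_min ct; lra.
  have fyr : f y - f r < f t - M.
    by apply: le_lt_trans (ler_norm _) _; apply: fd; lra.
  suff : f t <= f y by lra.
  have [->//|yt'] := eqVneq y t.
  suff : f t - f y <= -1 * (t - y) by lra.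
  apply: dec => //; first lra.
  move=> z /andP[yz zt]; rewrite leNgt; apply/negP => fz.
  have : z <= sup S by apply: sup_upper_bound => //; split; [lra | exact: ltW].
  have : y = sup S + d / 4; last lra.
  by move: yt'; rewrite /y; case: leP => //; rewrite eqxx.
(* After a time [f t0 - M] spent above [M], the loss would have brought [f] down to [M]. *)
have [s [t0s fs]] : exists s, t0 <= s /\ f s <= M.
  apply: contrapT => /forallNP fM.
  have fM' s : t0 <= s -> M < f s.
    by move=> t0s; rewrite ltNge; apply/negP => fs; apply: (fM s).
  have Mt0 := fM' t0 (lexx _).
  have := @dec t0 (t0 + (f t0 - M)) (lexx _).
  have := fM' (t0 + (f t0 - M)).
  have H : t0 <= t0 + (f t0 - M) by lra.
  move=> /(_ H) h /(_ H) => h'.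
  suff : f (t0 + (f t0 - M)) - f t0 <= -1 * (t0 + (f t0 - M) - t0) by lra.
  by apply: h' => r /andP[t0r _]; apply/ltW/fM'.
by exists s => // t st; exact: trap st fs.
Qed.

(** * Quadratic Lyapunov function *)

(** The threshold [K] solves $K^{r-1} = e$: past it $s^r \le e s$, and below it monotonicity bounds
    $s^r$ by $K^r$. *)
Lemma powR_le_linear (R : realType) (r e : R) : 0 <= r -> r < 1 -> 0 < e ->
  exists2 C : R, 0 <= C & forall s, 0 <= s -> s `^ r <= e * s + C.
Proof.
move=> r0 r1 e0; pose K := e `^ (- (1 - r)^-1).
exists (K `^ r); first exact: powR_ge0.
move=> s s0; have [sK|Ks] := leP s K.
  apply: le_trans (ge0_ler_powR r0 _ _ sK) _; rewrite ?nnegrE ?powR_ge0//.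
  by rewrite lerDr mulr_ge0// ltW.
have K0 : 0 < K by exact: powR_gt0.
have s0' : 0 < s by exact: lt_trans Ks.
apply: (@le_trans _ _ (e * s)); last by rewrite lerDl powR_ge0.
have -> : s `^ r = s `^ (- (1 - r)) * s.
  have := @powRD _ s (- (1 - r)) 1; rewrite powRr1 ?ltW// (gt_eqF s0') implybT => <- //.
  by congr powR; ring.
rewrite ler_wpM2r// powRN -[leRHS]invrK lef_pV2 ?posrE ?invr_gt0 ?powR_gt0//.
have -> : e^-1 = K `^ (1 - r).
  by rewrite -powRrM mulNr mulVf ?powR_inv1 ?ltW//; lra.
by apply: ge0_ler_powR; rewrite ?nnegrE ?ltW//; lra.
Qed.

(** The left side is a power of [s] with exponent [2 * q + 1], strictly between 0 and 1. *)
Lemma sqr_powR_mul_le_linear (R : realType) (q e : R) :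
  - (1 / 2) < q -> q < 0 -> 0 < e ->
  exists2 C : R, 0 <= C & forall s, 0 <= s -> (s `^ q) ^+ 2 * s <= e * s + C.
Proof.
move=> q1 q0 e0; have [||C C0 HC] := @powR_le_linear _ (2 * q + 1) e _ _ e0; [lra..|].
exists C => // s; rewrite le_eqVlt => /predU1P[<-|s0]; first by rewrite !mulr0 add0r.
apply: le_trans (HC s (ltW s0)).
have := @powRD _ s (2 * q) 1; rewrite powRr1 ?(ltW s0)// (gt_eqF s0) implybT => -> //.
by rewrite -powR_mulrn ?powR_ge0// -powRrM [q * _]mulrC.
Qed.

(** * Euclidean product and binary quadratic forms *)

Lemma edotE (R : realType) (n : nat) (x y : 'cV[R]_n) :
  edot x y = \sum_(i < n) x i 0 * y i 0.
Proof. by rewrite /edot mxE; apply: eq_bigr => i _; rewrite mxE. Qed.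

Lemma edot_ge0 (R : realType) (n : nat) (x : 'cV[R]_n) : 0 <= edot x x.
Proof. by rewrite edotE sumr_ge0// => i _; rewrite -expr2 sqr_ge0. Qed.

Lemma edotZ (R : realType) (n : nat) (c : R) (x : 'cV[R]_n) :
  edot (c *: x) (c *: x) = c ^+ 2 * edot x x.
Proof. by rewrite !edotE mulr_sumr; apply: eq_bigr => i _; rewrite !mxE; ring. Qed.

Lemma edotD_le (R : realType) (n : nat) (x y : 'cV[R]_n) :
  edot (x + y) (x + y) <= 2 * edot x x + 2 * edot y y.
Proof.
rewrite !edotE !mulr_sumr -big_split; apply: ler_sum => i _ /=.
by rewrite !mxE; have := sqr_ge0 (x i 0 - y i 0); lra.
Qed.

Lemma edot_le_enorm (R : realType) (n : nat) (x : 'cV[R]_n) (m : R) :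
  enorm x <= m -> edot x x <= m ^+ 2.
Proof.
move=> xm; rewrite -[leLHS]sqr_sqrtr ?edot_ge0//.
by rewrite lerXn2r ?nnegrE ?sqrtr_ge0// (le_trans _ xm)// sqrtr_ge0.
Qed.

(** The form of a symmetric matrix, its off-diagonal entry read above the diagonal. The form of [S]
    tensored with the identity is a sum of such terms, one per coordinate. *)
Definition qform2 (R : realType) (S : 'M[R]_2) (u v : R) : R :=
  S 0 0 * u ^+ 2 + 2 * S 0 1 * (u * v) + S 1 1 * v ^+ 2.

Lemma posdef_qform2_gt0 (R : realType) (S : 'M[R]_2) : posdef S ->
  forall u v, (u != 0) || (v != 0) -> 0 < qform2 S u v.
Proof.
move=> [S_sym S_gt0] u v uv0.
pose x : 'cV[R]_2 := \col_i (if i == 0 then u else v).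
have x0 : x != 0.
  apply: contraL uv0 => /eqP x0; rewrite negb_or !negbK.
  have := congr1 (fun y : 'cV_2 => y 0 0) x0.
  have := congr1 (fun y : 'cV_2 => y 1 0) x0.
  by rewrite !mxE /= => -> ->; rewrite eqxx.
have -> : qform2 S u v = edot x (S *m x).
  have S10 : S 1 0 = S 0 1 by rewrite -[in LHS]S_sym mxE.
  rewrite edotE !big_ord_recl big_ord0 !mxE !big_ord_recl !big_ord0 /=.
  rewrite !mxE /= (_ : lift 0 0 = 1); last exact/val_inj.
  by rewrite S10 /qform2; ring.
exact: S_gt0.
Qed.

Lemma posdef_qform2_ge (R : realType) (S : 'M[R]_2) : posdef S ->
  exists2 c, 0 < c & forall u v, c * (u ^+ 2 + v ^+ 2) <= qform2 S u v.
Proof.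
move=> /posdef_qform2_gt0; rewrite /qform2.
set a := S 0 0; set b := S 0 1; set d := S 1 1 => S_gt0.
have a0 : 0 < a by have := S_gt0 1 0; rewrite oner_eq0 /= => /(_ isT); lra.
have d0 : 0 < d by have := S_gt0 0 1; rewrite oner_eq0 orbT /= => /(_ isT); lra.
have det0 : 0 < a * d - b ^+ 2.
  (* The vector $(b, -a)$ gives the form the value $a (ad - b^2)$. *)
  have := S_gt0 b (- a); rewrite oppr_eq0 (gt_eqF a0) orbT => /(_ isT) H.
  by rewrite -(pmulr_rgt0 _ a0); lra.
have ad0 : 0 < a + d by rewrite addr_gt0.
(* Determinant over trace is a lower bound for the smaller eigenvalue. *)
exists ((a * d - b ^+ 2) / (a + d)) => [|u v]; first by rewrite divr_gt0.
set c := _ / _.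
have cE : c * (a + d) = a * d - b ^+ 2 by rewrite /c divfK// gt_eqF.
have ac : 0 < a - c.
  rewrite -(pmulr_rgt0 _ ad0).
  have -> : (a + d) * (a - c) = a ^+ 2 + b ^+ 2 by rewrite mulrBr [_ * c]mulrC cE; ring.
  by rewrite ltr_wpDr ?sqr_ge0// exprn_gt0.
rewrite -subr_ge0 -(pmulr_rge0 _ ac).
(* Completing the square; this [c] gives $S - c I$ the determinant $c^2$. *)
have -> : (a - c) * (a * u ^+ 2 + 2 * b * (u * v) + d * v ^+ 2
    - c * (u ^+ 2 + v ^+ 2)) =
  ((a - c) * u + b * v) ^+ 2 + (c * v) ^+ 2 + (a * d - b ^+ 2 - c * (a + d)) * v ^+ 2.
  by ring.
by rewrite cE subrr mul0r addr0 addr_ge0 ?sqr_ge0.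
Qed.

(** The values at $(u, v)$ and at the orthogonal vector $(v, -u)$ are nonnegative and add up to the
    trace times $u^2 + v^2$. *)
Lemma posdef_qform2_le (R : realType) (S : 'M[R]_2) : posdef S ->
  exists2 c, 0 < c & forall u v, qform2 S u v <= c * (u ^+ 2 + v ^+ 2).
Proof.
move=> /posdef_qform2_ge[c c0 Sc]; exists (S 0 0 + S 1 1) => [|u v].
  by have := Sc 1 0; have := Sc 0 1; rewrite /qform2; lra.
have := Sc v (- u); have := mulr_ge0 (ltW c0) (addr_ge0 (sqr_ge0 v) (sqr_ge0 (- u))).
by rewrite /qform2; lra.
Qed.

(** * Decay of the form and size of the perturbation *)

Lemma mulr_young (R : realType) (a b e : R) : 0 < e ->
  2 * (a * b) <= e * b ^+ 2 + a ^+ 2 / e.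
Proof.
move=> e0; rewrite -subr_ge0.
have -> : e * b ^+ 2 + a ^+ 2 / e - 2 * (a * b) = (e * b - a) ^+ 2 / e by field; lra.
by rewrite divr_ge0 ?sqr_ge0// ltW.
Qed.

(* With u = e1 and v = e2 / k3, componentwise, d1 = phi1 - k3 e1 and
   d2 = phi2 / k3 - k3 e1 are the deviations of the noisy nonlinearities from
   their linear parts. *)
Lemma lyapunov_qform2_decay (R : realType) (k1 k2 k3 : R) (P Q : 'M[R]_2) :
  0 < k3 -> posdef P -> posdef Q ->
  (Astar k1 k2)^T *m P + P *m Astar k1 k2 = - Q ->
  exists2 c, 0 < c & exists2 C, 0 <= C & forall u v d1 d2 : R,
    let u' := k3 * (- k1 * u + v) - k1 * d1 in
    let v' := - k2 * k3 * u - k2 * d2 in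
    2 * (P 0 0 * (u * u') + P 0 1 * (u * v' + v * u') + P 1 1 * (v * v'))
      <= - c * (u ^+ 2 + v ^+ 2) + C * (d1 ^+ 2 + d2 ^+ 2).
Proof.
move=> k30 [P_sym _] /posdef_qform2_ge[q q0 Qq] lyap.
have l0 : (0 : 'I_2) = lshift 1 (0 : 'I_1) by exact/val_inj.
have r1 : (1 : 'I_2) = rshift 1 (0 : 'I_1) by exact/val_inj.
have A00 : Astar k1 k2 0 0 = - k1.
  by rewrite l0; apply: etrans (block_mxEul _ _ _ _ _ _) _; rewrite mxE.
have A01 : Astar k1 k2 0 1 = 1.
  by rewrite l0 r1; apply: etrans (block_mxEur _ _ _ _ _ _) _; rewrite mxE.
have A10 : Astar k1 k2 1 0 = - k2.
  by rewrite l0 r1; apply: etrans (block_mxEdl _ _ _ _ _ _) _; rewrite mxE.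
have A11 : Astar k1 k2 1 1 = 0.
  by rewrite r1; apply: etrans (block_mxEdr _ _ _ _ _ _) _; rewrite mxE.
have P10 : P 1 0 = P 0 1 by rewrite -[in LHS]P_sym mxE.
have lift1 : lift 0 0 = 1 :> 'I_2 by exact/val_inj.
have ord00 : ord0 = 0 :> 'I_2 by exact/val_inj.
move: (Astar k1 k2) lyap A00 A01 A10 A11 => A lyap A00 A01 A10 A11.
have lyapE i j := congr1 (fun M : 'M[R]_2 => M i j) lyap.
have := lyapE 0 0; have := lyapE 0 1; have := lyapE 1 1.
rewrite !mxE !big_ord_recl !big_ord0 !mxE !lift1 !ord00 A00 A01 A10 A11 P10 => l11 l01 l00.
(* Each of the four cross terms costs [e * u ^+ 2] or [e * v ^+ 2]; in total half of the decay rate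
   [k3 * q] is spent. *)
pose e := k3 * q / 4.
have e0 : 0 < e by rewrite /e divr_gt0// mulr_gt0.
exists (k3 * q / 2); first by rewrite divr_gt0// mulr_gt0.
pose C1 := (k1 ^+ 2 * (P 0 0 ^+ 2 + P 0 1 ^+ 2)) / e.
pose C2 := (k2 ^+ 2 * (P 0 1 ^+ 2 + P 1 1 ^+ 2)) / e.
have C10 : 0 <= C1 by rewrite /C1 divr_ge0 ?(ltW e0)// mulr_ge0 ?addr_ge0 ?sqr_ge0.
have C20 : 0 <= C2 by rewrite /C2 divr_ge0 ?(ltW e0)// mulr_ge0 ?addr_ge0 ?sqr_ge0.
exists (C1 + C2) => [|u v d1 d2 /=]; first by rewrite addr_ge0.
have h1 := mulr_young (- k1 * P 0 0 * d1) u e0.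
have h2 := mulr_young (- k1 * P 0 1 * d1) v e0.
have h3 := mulr_young (- k2 * P 0 1 * d2) u e0.
have h4 := mulr_young (- k2 * P 1 1 * d2) v e0.
have hQ := ler_wpM2l (ltW k30) (Qq u v).
have C1E : C1 * d1 ^+ 2 = (- k1 * P 0 0 * d1) ^+ 2 / e + (- k1 * P 0 1 * d1) ^+ 2 / e.
  by rewrite /C1; field; lra.
have C2E : C2 * d2 ^+ 2 = (- k2 * P 0 1 * d2) ^+ 2 / e + (- k2 * P 1 1 * d2) ^+ 2 / e.
  by rewrite /C2; field; lra.
have C1d2 := mulr_ge0 C10 (sqr_ge0 d2).
have C2d1 := mulr_ge0 C20 (sqr_ge0 d1).
(* The linear part of the field yields exactly [- (k3 * qform2 Q u v)] by the Lyapunov equation; the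
   four remaining terms come from [d1] and [d2]. *)
have -> : 2 * (P 0 0 * (u * (k3 * (- k1 * u + v) - k1 * d1)) +
     P 0 1 * (u * (- k2 * k3 * u - k2 * d2) + v * (k3 * (- k1 * u + v) - k1 * d1)) +
     P 1 1 * (v * (- k2 * k3 * u - k2 * d2))) =
  - (k3 * qform2 Q u v) + 2 * (- k1 * P 0 0 * d1 * u) + 2 * (- k1 * P 0 1 * d1 * v)
  + 2 * (- k2 * P 0 1 * d2 * u) + 2 * (- k2 * P 1 1 * d2 * v).
  (* The double negation exposes the entries of [- Q], which the Lyapunov equation then replaces. *)
  have Q00 : Q 0 0 = - - Q 0 0 by rewrite opprK.
  have Q01 : Q 0 1 = - - Q 0 1 by rewrite opprK.
  have Q11 : Q 1 1 = - - Q 1 1 by rewrite opprK.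
  by rewrite /qform2 Q00 Q01 Q11 -l00 -l01 -l11; ring.
have eE : k3 * (q * (u ^+ 2 + v ^+ 2)) = 4 * (e * u ^+ 2 + e * v ^+ 2).
  by rewrite /e; field.
have -> : - (k3 * q / 2) * (u ^+ 2 + v ^+ 2) = - 2 * (e * u ^+ 2 + e * v ^+ 2).
  by rewrite /e; field.
have -> : (C1 + C2) * (d1 ^+ 2 + d2 ^+ 2) =
    C1 * d1 ^+ 2 + C2 * d2 ^+ 2 + C1 * d2 ^+ 2 + C2 * d1 ^+ 2 by ring.
rewrite C1E C2E.
lra.
Qed.

(** With $z = x + \mu$ and $s = |z|^2$, both deviations are [k3 *: mu] plus a multiple of $z$ by
    negative powers of $s$. The squared norms of these multiples are controlled by terms $s^{2q+1}$
    with exponent below 1. *)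
Lemma homogeneous_perturbation_le (R : realType) (n : nat) (p k3 m e : R) :
  1 < p -> p < 2 -> 0 < k3 -> 0 < e ->
  exists C, forall x mu : 'cV[R]_n, enorm mu <= m ->
    let d1 := phi1 p k3 (x + mu) - k3 *: x in
    let d2 := k3^-1 *: phi2 p k3 (x + mu) - k3 *: x in
    edot d1 d1 + edot d2 d2 <= e * edot x x + C.
Proof.
move=> p1 p2 k30 e0.
have p3 : 0 < 3 * p - 2 by lra.
set q1 := (1 - p) / (3 * p - 2); set q2 := 2 * (1 - p) / (3 * p - 2).
pose c1 := 2 * k3 * (2 * p - 1) / (3 * p - 2); pose c2 := p / (3 * p - 2).
(* [A1] and [A2] collect the coefficients of $s^{2q_1} s$ and $s^{2q_2} s$ once the squares of sums
   are split. *)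
pose A1 := 2 + 4 * (c1 / k3) ^+ 2; pose A2 := 4 * (c2 / k3) ^+ 2.
have A10 : 0 < A1 by rewrite /A1 ltr_wpDr// mulr_ge0 ?sqr_ge0.
have A20 : 0 <= A2 by rewrite /A2 mulr_ge0 ?sqr_ge0.
have A0 : 0 < A1 + A2 by rewrite ltr_wpDr.
(* This makes [(A1 + A2) * e'] equal to [e / 2]; the factor 2 in $|z|^2 \le 2|x|^2 + 2|\mu|^2$
   restores [e]. *)
pose e' := e / (2 * (A1 + A2)).
have e'0 : 0 < e' by rewrite /e' divr_gt0// mulr_gt0.
have q10 : q1 < 0 by rewrite /q1 ltr_pdivrMr//; lra.
have q11 : - (1 / 2) < q1 by rewrite /q1 ltr_pdivlMr//; lra.
have q20 : q2 < 0 by rewrite /q2 ltr_pdivrMr//; lra.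
(* The bound [p < 2] is exactly what keeps this exponent above $-1/2$. *)
have q21 : - (1 / 2) < q2 by rewrite /q2 ltr_pdivlMr//; lra.
have [C1 C10 HC1] := sqr_powR_mul_le_linear q11 q10 e'0.
have [C2 C20 HC2] := sqr_powR_mul_le_linear q21 q20 e'0.
exists (4 * k3 ^+ 2 * m ^+ 2 + A1 * C1 + A2 * C2 + e * m ^+ 2).
move=> x mu /edot_le_enorm mum /=.
set d1 := phi1 _ _ _ - _; set d2 := _ *: phi2 _ _ _ - _.
set z := x + mu in d1 d2 *; pose s := edot z z.
pose a1 := s `^ q1; pose a2 := s `^ q2.
have d1E : d1 = k3 *: mu + a1 *: z.
  rewrite /d1 /phi1 -/q1 -/s -/a1 addrAC -scalerBr.
  by rewrite /z [x + mu]addrC addrK.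
have d2E : d2 = k3 *: mu + ((c1 * a1 + c2 * a2) / k3) *: z.
  rewrite /d2 /phi2 -/q1 -/q2 -/s -/a1 -/a2 -/c1 -/c2 -addrA -scalerDl scalerDr !scalerA.
  rewrite [k3^-1 * (_ + _)]mulrC (_ : k3^-1 * k3 ^+ 2 = k3); last by field; lra.
  rewrite addrAC -scalerBr.
  by rewrite {1}/z [x + mu]addrC addrK.
have s0 : 0 <= s by exact: edot_ge0.
have h1 := edotD_le (k3 *: mu) (a1 *: z).
have h2 := edotD_le (k3 *: mu) (((c1 * a1 + c2 * a2) / k3) *: z).
rewrite d1E d2E; apply: le_trans (lerD h1 h2) _; rewrite !edotZ -/s.
have b1 : a1 ^+ 2 * s <= e' * s + C1 by exact: HC1.
have b2 : a2 ^+ 2 * s <= e' * s + C2 by exact: HC2.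
have b3 : ((c1 * a1 + c2 * a2) / k3) ^+ 2 * s <=
    2 * (c1 / k3) ^+ 2 * (a1 ^+ 2 * s) + 2 * (c2 / k3) ^+ 2 * (a2 ^+ 2 * s).
  have -> : (c1 * a1 + c2 * a2) / k3 = c1 / k3 * a1 + c2 / k3 * a2.
    by rewrite mulrDl !(mulrAC _ _ k3^-1).
  have := mulr_ge0 (sqr_ge0 (c1 / k3 * a1 - c2 / k3 * a2)) s0.
  move: (c1 / k3) (c2 / k3) => r1 r2; lra.
have b4 : s <= 2 * edot x x + 2 * edot mu mu by exact: edotD_le.
have b5 : k3 ^+ 2 * edot mu mu <= k3 ^+ 2 * m ^+ 2 by rewrite ler_wpM2l// sqr_ge0.
have b6 : A1 * (a1 ^+ 2 * s) <= A1 * (e' * s + C1) by rewrite ler_wpM2l// ltW.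
have b7 : A2 * (a2 ^+ 2 * s) <= A2 * (e' * s + C2) by rewrite ler_wpM2l.
have eE : A1 * (e' * s) + A2 * (e' * s) = e / 2 * s.
  by rewrite /e'; field; lra.
have b8 : e / 2 * s <= e * edot x x + e * m ^+ 2.
  have -> : e * edot x x + e * m ^+ 2 = e / 2 * (2 * edot x x + 2 * m ^+ 2) by field.
  by rewrite ler_pM2l ?divr_gt0//; lra.
have A1E : A1 * (a1 ^+ 2 * s) = 2 * (a1 ^+ 2 * s) + 4 * (c1 / k3) ^+ 2 * (a1 ^+ 2 * s).
  by rewrite /A1 mulrDl.
have A2E : A2 * (a2 ^+ 2 * s) = 4 * (c2 / k3) ^+ 2 * (a2 ^+ 2 * s) by [].
rewrite mulrDr A1E in b6; rewrite mulrDr A2E in b7.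
move: b1 b2 b3 b5 b6 b7 b8 eE; clear.
move: (a1 ^+ 2 * s) (a2 ^+ 2 * s) (((c1 * a1 + c2 * a2) / k3) ^+ 2 * s) => T1 T2 T3.
move: (A1 * (e' * s)) (A2 * (e' * s)) (e / 2 * s) => T4 T5 T6.
move: ((c1 / k3) ^+ 2) ((c2 / k3) ^+ 2) => r1 r2.
lra.
Qed.

(** * Coordinates of the state space *)

Lemma mx_entry_le_norm (R : realType) (m n : nat) (A : 'M[R]_(m, n)) i j :
  `|A i j| <= `|A|.
Proof.
rewrite [leRHS]/Num.Def.normr/= mx_normrE.
by apply: (le_bigmax _ (fun k : 'I_m * 'I_n => `|A k.1 k.2|) (i, j)).
Qed.

Lemma mx_norm_le (R : realType) (m n : nat) (A : 'M[R]_(m, n)) (c : R) : 0 <= c ->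
  (forall i j, `|A i j| <= c) -> `|A| <= c.
Proof.
by move=> c0 Ac; rewrite [leLHS]/Num.Def.normr/= mx_normrE (bigmax_le _ c0).
Qed.

(** Linearity lets [L] pass through the difference quotient, continuity through its limit. *)
Lemma is_derive1_linear (R : realType) (V W : normedModType R)
    (L : {linear V -> W}) (f : R -> V) (t : R) (l : V) :
  continuous L -> is_derive t 1 f l -> is_derive t 1 (L \o f) (L l).
Proof.
move=> cL [df fl].
have H : (h^-1 *: (((L \o f) \o shift t) (h *: (1 : R)) - (L \o f) t) @[h --> 0^'])
    --> L l.
  rewrite (_ : (fun h => _) = L \o (fun h => h^-1 *: ((f \o shift t) (h *: (1:R)) - f t))).
    apply: continuous_cvg; first exact: cL.
    by rewrite -fl; exact: df.
  by apply/funext => h; rewrite /= -linearB -linearZ.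
by split; [apply: cvgP H | exact: cvg_lim H].
Qed.

(** As continuous linear functionals, the coordinates turn the vector equation into scalar ones;
    being 1-Lipschitz, they preserve absolute continuity. *)
Definition entry1 (R : realType) (n : nat) (i : 'I_n)
  (e : 'cV[R]_n * 'cV[R]_n) : R := e.1 i 0.
Definition entry2 (R : realType) (n : nat) (i : 'I_n)
  (e : 'cV[R]_n * 'cV[R]_n) : R := e.2 i 0.

Fact entry1_is_linear (R : realType) (n : nat) (i : 'I_n) :
  linear (@entry1 R n i).
Proof. by move=> c x y; rewrite /entry1 /= !mxE. Qed.
HB.instance Definition _ (R : realType) (n : nat) (i : 'I_n) :=
  GRing.isLinear.Build R ('cV[R]_n * 'cV[R]_n)%type R _ (@entry1 R n i)
    (@entry1_is_linear R n i).

Fact entry2_is_linear (R : realType) (n : nat) (i : 'I_n) :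
  linear (@entry2 R n i).
Proof. by move=> c x y; rewrite /entry2 /= !mxE. Qed.
HB.instance Definition _ (R : realType) (n : nat) (i : 'I_n) :=
  GRing.isLinear.Build R ('cV[R]_n * 'cV[R]_n)%type R _ (@entry2 R n i)
    (@entry2_is_linear R n i).

Lemma entry1_continuous (R : realType) (n : nat) (i : 'I_n) :
  continuous (@entry1 R n i).
Proof.
move=> e; apply: (@continuous_cvg _ _ _ _ _ fst (fun u : 'cV[R]_n => u i 0)).
  exact: coord_continuous.
exact: cvg_fst.
Qed.

Lemma entry2_continuous (R : realType) (n : nat) (i : 'I_n) :
  continuous (@entry2 R n i).
Proof.
move=> e; apply: (@continuous_cvg _ _ _ _ _ snd (fun u : 'cV[R]_n => u i 0)).
  exact: coord_continuous.
exact: cvg_snd.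
Qed.

Lemma entry1_le_norm (R : realType) (n : nat) (i : 'I_n)
  (e : 'cV[R]_n * 'cV[R]_n) : `|entry1 i e| <= `|e|.
Proof.
by apply: le_trans (mx_entry_le_norm _ _ _) _; rewrite prod_normE le_max lexx.
Qed.

Lemma entry2_le_norm (R : realType) (n : nat) (i : 'I_n)
  (e : 'cV[R]_n * 'cV[R]_n) : `|entry2 i e| <= `|e|.
Proof.
by apply: le_trans (mx_entry_le_norm _ _ _) _; rewrite prod_normE le_max lexx orbT.
Qed.

Lemma norm_le_entries (R : realType) (n : nat) (e : 'cV[R]_n * 'cV[R]_n) (c : R) :
  0 <= c -> (forall i, `|entry1 i e| <= c) -> (forall i, `|entry2 i e| <= c) ->
  `|e| <= c.
Proof.
move=> c0 h1 h2; rewrite prod_normE ge_max; apply/andP.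
by split; apply: mx_norm_le => // i j; rewrite ord1; [exact: h1|exact: h2].
Qed.

(** * The Lyapunov function along solutions *)

Lemma abs_continuous_on_qform2 (R : realType) (S : 'M[R]_2) (a b : R)
    (f g : R -> R) : a <= b ->
  abs_continuous_on a b f -> abs_continuous_on a b g ->
  abs_continuous_on a b (fun t => qform2 S (f t) (g t)).
Proof.
move=> ab acf acg.
have acZ c (h : R -> R) : abs_continuous_on a b h ->
    abs_continuous_on a b (fun t => c * h t).
  by apply: (abs_continuous_on_lip (k := `|c|)) => s t _ _; rewrite -mulrBr normrM.
apply: abs_continuous_onD; first apply: abs_continuous_onD; apply: acZ.
- exact: (abs_continuous_onM ab acf acf).
- exact: (abs_continuous_onM ab acf acg).
- exact: (abs_continuous_onM ab acg acg).
Qed.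

Lemma is_derive_qform2 (R : realType) (S : 'M[R]_2) (f g : R -> R) (t u' v' : R) :
  is_derive t 1 f u' -> is_derive t 1 g v' ->
  is_derive t 1 (fun t => qform2 S (f t) (g t))
    (2 * (S 0 0 * (f t * u') + S 0 1 * (f t * v' + g t * u') + S 1 1 * (g t * v'))).
Proof.
move=> df dg.
have -> : (fun t => qform2 S (f t) (g t)) =
    S 0 0 \*: (f * f) + (2 * S 0 1) \*: (f * g) + S 1 1 \*: (g * g) by [].
by apply: is_derive_eq; rewrite /GRing.scale /=; ring.
Qed.

(** For symmetric [P] this is the form of [P] tensored with the identity, at $(e_1, e_2 / k_3)$. *)
Definition lyapunov_fun (R : realType) (n : nat) (k3 : R) (P : 'M[R]_2)
    (e : 'cV[R]_n * 'cV[R]_n) : R :=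
  \sum_(i < n) qform2 P (entry1 i e) (k3^-1 * entry2 i e).

Lemma lyapunov_fun_abs_continuous (R : realType) (n : nat) (k3 : R) (P : 'M[R]_2)
    (a b : R) (x : R -> 'cV[R]_n * 'cV[R]_n) : a <= b ->
  abs_continuous_on a b x ->
  abs_continuous_on a b (lyapunov_fun k3 P \o x).
Proof.
move=> ab acx.
have -> : lyapunov_fun k3 P \o x = \sum_(i < n)
    (fun t => qform2 P (entry1 i (x t)) (k3^-1 * entry2 i (x t))).
  by apply/funext => t; rewrite fct_sumE.
apply: abs_continuous_on_sum => i; apply: abs_continuous_on_qform2 => //.
  apply: (abs_continuous_on_lip (k := 1)) acx => s t _ _.
  by rewrite -linearB mul1r entry1_le_norm.
apply: (abs_continuous_on_lip (k := `|k3^-1|)) acx => s t _ _.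
by rewrite -mulrBr -linearB normrM ler_wpM2l// entry2_le_norm.
Qed.

Lemma lyapunov_fun_decay (R : realType) (n : nat) (p k1 k2 k3 : R)
    (P Q : 'M[R]_2) (m : R) :
  1 < p -> p < 2 -> 0 < k3 -> posdef P -> posdef Q ->
  (Astar k1 k2)^T *m P + P *m Astar k1 k2 = - Q ->
  exists2 M, 0 < M & forall (mu : R -> 'cV[R]_n) (x : R -> 'cV[R]_n * 'cV[R]_n) (t : R),
    enorm (mu t) <= m -> is_derive t 1 x (noisy_system p k1 k2 k3 (mu t) (x t)) ->
    M <= lyapunov_fun k3 P (x t) ->
    exists2 l : R, l <= -1 & is_derive t 1 (lyapunov_fun k3 P \o x) l.
Proof.
move=> p1 p2 k30 hP hQ lyap.
have [c c0 [C1 C10 decay]] := lyapunov_qform2_decay k30 hP hQ lyap.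
have [b b0 Pb] := posdef_qform2_le hP.
have C11 : 0 < C1 + 1 by rewrite ltr_wpDl.
(* Then [C1 * e] is at most [c / 2]; the added 1 guards against [C1 = 0]. *)
pose e := c / (2 * (C1 + 1)).
have e0 : 0 < e by rewrite divr_gt0// mulr_gt0.
have [C2 pert] := @homogeneous_perturbation_le R n p k3 m e p1 p2 k30 e0.
(* The function is at most [b * s], so a value of at least [M] forces [c / 2 * s] to be at least the
   constant error plus 1. The absolute value covers a [C2] of unknown sign. *)
pose M := 2 * b / c * (`|C1 * C2| + 1).
have M0 : 0 < M by rewrite /M mulr_gt0 ?divr_gt0 ?mulr_gt0// ltr_wpDl.
exists M => // mu x t mum dx Mx.
pose d1 := phi1 p k3 ((x t).1 + mu t) - k3 *: (x t).1.
pose d2 := k3^-1 *: phi2 p k3 ((x t).1 + mu t) - k3 *: (x t).1.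
(* Substituting $\phi_1 = d_1 + k_3 e_1$ and $\phi_2 = k_3 (d_2 + k_3 e_1)$ in each coordinate puts
   the field in the form of [lyapunov_qform2_decay]. *)
pose u i := entry1 i (x t); pose v i := k3^-1 * entry2 i (x t).
pose u' i := k3 * (- k1 * u i + v i) - k1 * d1 i 0.
pose v' i := - k2 * k3 * u i - k2 * d2 i 0.
have du i : is_derive t 1 (fun t => entry1 i (x t)) (u' i).
  apply: is_derive_eq (is_derive1_linear (@entry1_continuous R n i) dx) _.
  rewrite /= /u' /d1 /u /v /entry1 /entry2 /=.
  by move: (phi1 _ _ _) => y; rewrite !mxE; field; lra.
have dv i : is_derive t 1 (fun t => k3^-1 * entry2 i (x t)) (v' i).
  have dy := is_derive1_linear (@entry2_continuous R n i) dx.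
  apply: is_derive_eq (is_deriveZ k3^-1 dy) _.
  rewrite /= /v' /d2 /u /v /entry1 /entry2 /=.
  by move: (phi2 _ _ _) => y; rewrite !mxE /GRing.scale /=; field; lra.
pose D i := 2 * (P 0 0 * (u i * u' i) + P 0 1 * (u i * v' i + v i * u' i)
   + P 1 1 * (v i * v' i)).
exists (\sum_(i < n) D i); last first.
  have -> : lyapunov_fun k3 P \o x = \sum_(i < n)
      (fun t => qform2 P (entry1 i (x t)) (k3^-1 * entry2 i (x t))).
    by apply/funext => s; rewrite fct_sumE.
  by apply: is_derive_sum => i; exact: is_derive_qform2.
pose s := \sum_(i < n) (u i ^+ 2 + v i ^+ 2).
have Ds : \sum_(i < n) D i <= - c * s + C1 * (edot d1 d1 + edot d2 d2).
  rewrite !edotE /s -big_split /= !mulr_sumr -big_split /=; apply: ler_sum => i _.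
  by apply: le_trans (decay _ _ _ _) _; rewrite !expr2.
have ds := pert (x t).1 (mu t) mum; rewrite -/d1 -/d2 in ds.
have us : edot (x t).1 (x t).1 <= s.
  by rewrite edotE; apply: ler_sum => i _; rewrite -expr2 lerDl sqr_ge0.
have Ms : M <= b * s.
  by apply: le_trans Mx _; rewrite /s mulr_sumr; apply: ler_sum => i _; exact: Pb.
have h1 : C1 * (edot d1 d1 + edot d2 d2) <= C1 * (e * s + C2).
  by rewrite ler_wpM2l// (le_trans ds)// lerD2r ler_pM2l.
have s0 : 0 <= s by apply: sumr_ge0 => i _; rewrite addr_ge0 ?sqr_ge0.
have h2 : C1 * (e * s) <= c / 2 * s.
  rewrite mulrA ler_wpM2r//.
  have -> : c / 2 = (C1 + 1) * e by rewrite /e; field; lra.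
  by rewrite ler_wpM2r ?ltW// ltrDl.
have h3 : `|C1 * C2| + 1 <= c / 2 * s.
  rewrite -(ler_pM2l b0).
  have -> : b * (c / 2 * s) = c / 2 * (b * s) by ring.
  have -> : b * (`|C1 * C2| + 1) = c / 2 * M by rewrite /M; field; lra.
  by rewrite ler_pM2l// divr_gt0.
have h4 := ler_norm (C1 * C2).
rewrite mulrDr in h1.
have h5 : c * s = 2 * (c / 2 * s) by field.
rewrite mulNr h5 in Ds.
lra.
Qed.

Lemma lyapunov_fun_sublevel_bounded (R : realType) (n : nat) (k3 : R)
    (P : 'M[R]_2) (M : R) : 0 < k3 -> posdef P -> 0 < M ->
  exists2 K, 0 < K & forall e : 'cV[R]_n * 'cV[R]_n,
    lyapunov_fun k3 P e <= M -> `|e| <= K.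
Proof.
move=> k30 /posdef_qform2_ge[a a0 Pa] M0.
have Ma0 : 0 < M / a by rewrite divr_gt0.
have k30' : 0 <= k3 * (1 + M / a) by rewrite mulr_ge0 ?addr_ge0// ltW.
have K0 : 0 < (1 + k3) * (1 + M / a) by rewrite mulr_gt0 ?addr_gt0.
(* The factor [1 + k3] covers both components, the second being [k3] times its rescaled
   coordinate. *)
exists ((1 + k3) * (1 + M / a)) => // e eM.
(* A single summand is already at most [M], the others being nonnegative. *)
have uv i : entry1 i e ^+ 2 + (k3^-1 * entry2 i e) ^+ 2 <= M / a.
  rewrite ler_pdivlMr// mulrC; apply: le_trans eM; apply: le_trans (Pa _ _) _.
  rewrite /lyapunov_fun (bigD1 i)//= lerDl; apply: sumr_ge0 => j _.
  by apply: le_trans (Pa _ _); rewrite mulr_ge0 ?(ltW a0)// addr_ge0 ?sqr_ge0.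
have abs_le (r B : R) : r ^+ 2 <= B -> `|r| <= 1 + B.
  by rewrite -real_normK ?num_real// => rB; have := sqr_ge0 (`|r| - 1); nra.
apply: norm_le_entries => [|i|i]; first exact: ltW.
  rewrite mulrDl mul1r; apply: ler_wpDr => //; apply: abs_le.
  by apply: le_trans (uv i); rewrite lerDl sqr_ge0.
have -> : entry2 i e = k3 * (k3^-1 * entry2 i e) by rewrite mulVKf// gt_eqF.
rewrite normrM (gtr0_norm k30) mulrDl mul1r; apply: ler_wpDl; first lra.
rewrite ler_pM2l//; apply: abs_le.
by apply: le_trans (uv i); rewrite lerDr sqr_ge0.
Qed.

Theorem corollary2 (R : realType) (n : nat) (hn : (1 <= n)%N)
    (p k1 k2 k3 : R) (hp1 : 1 < p) (hp2 : p < 2)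
    (hk1 : 0 < k1) (hk2 : 0 < k2) (hk3 : 0 < k3)
    (hA : hurwitz (Astar k1 k2))
    (Qstar Pstar : 'M[R]_2) (hQ : posdef Qstar) (hP : posdef Pstar)
    (hlyap : (Astar k1 k2)^T *m Pstar + Pstar *m Astar k1 k2 = - Qstar)
    (mubar : R) :
  let P := tensmx Pstar (1%:M : 'M[R]_n) in
  let Q := tensmx Qstar (1%:M : 'M[R]_n) in
  lambda_max P / lambda_min P <= gamma1 k3 P Q ->
  practically_finite_time_stable
    [set mu : R -> 'cV[R]_n | forall t, enorm (mu t) <= mubar]
    (noisy_system p k1 k2 k3).
Proof.
move=> _ _ _.
have [M M0 decay] :=
  @lyapunov_fun_decay R n _ _ _ _ _ _ mubar hp1 hp2 hk3 hP hQ hlyap.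
have [K K0 sublevel] := @lyapunov_fun_sublevel_bounded R n k3 _ _ hk3 hP M0.
(* A closed ball is at once bounded and a neighborhood of the origin, and it contains the sublevel
   set of [M]. Its radius is fixed before the noise and the solution. *)
exists [set e | `|e| <= K]; split.
- apply/nbhs_ballP; exists K => // e; rewrite -ball_normE /= sub0r normrN.
  exact: ltW.
- exists K; split; first exact: num_real.
  by move=> r Kr e /= eK; exact: le_trans eK (ltW Kr).
move=> mu t0 x mum [acx dx].
have [||T t0T xT] := @eventually_le_of_derive_le R (lyapunov_fun k3 Pstar \o x) t0 M.
- by move=> b t0b; apply: lyapunov_fun_abs_continuous => //; exact: acx.
- apply: (@filterS _ _ (ae_filter_ringOfSetsType lebesgue_measure) _ _ _ dx).
  by move=> t xt t0t Mt; exact: decay (mum t) (xt t0t) Mt.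
by exists T => // t Tt; apply: sublevel; exact: xT.
Qed.
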